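(* Let $R$ be a maximal subring of a ring $T$ such that $(R:T)$ is a maximal ideal of $T$. Then the following hold: (1) If $R$ is a left Noetherian (resp. left Artinian) ring, then either $T$ is a left Noetherian (resp. left Artinian) ring or $(R:T)=(R:T)_l$, and in the latter case $(R:T)_l\subseteq (R:T)_r$ (resp. $(R:T)=(R:T)_l=(R:T)_r$). (2) If $R$ is a right Noetherian (resp. right Artinian) ring, then either $T$ is a right Noetherian (resp. right Artinian) ring or $(R:T)=(R:T)_r$, and in the latter case $(R:T)_r\subseteq (R:T)_l$ (resp. $(R:T)=(R:T)_l=(R:T)_r$).
   Context: All rings are associative, unital with $1\neq 0$, and not necessarily commutative; subrings contain the identity of the overring. A subring $R\subsetneq T$ is a maximal subring of $T$ if there is no subring $S$ with $R\subsetneq S\subsetneq T$. $(R:T):=\{x\in T\mid TxT\subseteq R\}$, $(R:T)_l:=\{x\in T\mid Tx\subseteq R\}$ and $(R:T)_r:=\{x\in T\mid xT\subseteq R\}$ are respectively the largest two-sided, left and right ideal of $T$ contained in $R$; all are two-sided ideals of $R$. *)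

(* Defs.v *)
From mathcomp Require Import all_boot all_algebra.
From mathcomp Require Import boolp classical_sets.

Set Implicit Arguments.
Unset Strict Implicit.
Unset Printing Implicit Defensive.

Import GRing.Theory.
Local Open Scope classical_set_scope.
Local Open Scope ring_scope.

(* A subring [A] of [T] is a set of elements of [T]; ideals of the ring [A],
   and hence its chain conditions, are sets of elements of [T] as well. The
   ring [T] itself is [[set: T]], the set of all its elements. *)
Section Definitions.
Variable T : nzRingType.
Implicit Types A I J R S : set T.

Definition is_subring R : Prop := GRing.subring_closed (mem R).

Definition maximal_subring R : Prop :=
  [/\ is_subring R, R `<` [set: T]
    & ~ exists S, [/\ is_subring S, R `<` S & S `<` [set: T]]].

Definition left_ideal A I : Prop :=
  [/\ I `<=` A, GRing.zmod_closed (mem I)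
    & forall a x, A a -> I x -> I (a * x)].

Definition right_ideal A I : Prop :=
  [/\ I `<=` A, GRing.zmod_closed (mem I)
    & forall a x, A a -> I x -> I (x * a)].

Definition two_sided_ideal A I : Prop := left_ideal A I /\ right_ideal A I.

Definition maximal_ideal A I : Prop :=
  [/\ two_sided_ideal A I, I `<` A
    & ~ exists J, [/\ two_sided_ideal A J, I `<` J & J `<` A]].

Definition ascending_chain_condition (P : set T -> Prop) : Prop :=
  forall F : nat -> set T,
    (forall n, P (F n)) -> (forall n, F n `<=` F n.+1) ->
    exists N, forall n, (N <= n)%N -> F n = F N.

Definition descending_chain_condition (P : set T -> Prop) : Prop :=
  forall F : nat -> set T,
    (forall n, P (F n)) -> (forall n, F n.+1 `<=` F n) ->
    exists N, forall n, (N <= n)%N -> F n = F N.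

Definition left_noetherian A := ascending_chain_condition (left_ideal A).
Definition right_noetherian A := ascending_chain_condition (right_ideal A).
Definition left_artinian A := descending_chain_condition (left_ideal A).
Definition right_artinian A := descending_chain_condition (right_ideal A).

(* (R:T), (R:T)_l and (R:T)_r. Since a subring [R] is closed under addition,
   TxT `<=` R amounts to all the products s * x * t being in [R]. *)
Definition conductor R : set T := [set x | forall s t, R (s * x * t)].
Definition left_conductor R : set T := [set x | forall t, R (t * x)].
Definition right_conductor R : set T := [set x | forall t, R (x * t)].

End Definitions.

(* Main.v *)
Require Import Defs.
From mathcomp Require Import all_boot all_algebra.
From mathcomp Require Import boolp classical_sets.

(** Write C for the conductor (R:T), and C_l, C_r for its one-sided analogues.
    Assertion (2) is assertion (1) for the converse ring of T, so only (1) needs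
    an argument.

    Suppose C_l <> C. The two-sided ideal of T generated by C_l strictly
    contains C, hence is T, so that 1 = a_1 t_1 + ... + a_k t_k with a_i in C_l.
    Thus t |-> (t a_1, ..., t a_k) embeds T, as a left R-module, in (C_l)^k, a
    power of a left ideal of R, and T inherits the chain conditions of R
    ([chain_condition_up]). Only the existence of finitely many elements of C_l
    without common left annihilator is used ([annihilator_free_seq]).

    The inclusion of C in C_r being clear, there remains to show that C_r = C if
    R is left Artinian and C = C_l. Suppose C_r <> C. Then T C_r = T, so a left
    ideal L of T is determined by the left ideal C_r :&: L of R, as
    L = T C_r L; hence T is left Artinian ([left_artinian_up]). Now T / C is
    simple left Artinian, and C_r / C is a proper right ideal of it, so some x
    outside of C satisfies x C_r <= C ([left_annihilator_mod]). Since R is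
    maximal, it is the idealizer of C_r ([idealizer_maximal]), so it contains
    T x. Hence x lies in C_l = C, a contradiction. *)

Set Implicit Arguments.
Unset Strict Implicit.
Unset Printing Implicit Defensive.

Import GRing.Theory.
Local Open Scope classical_set_scope.
Local Open Scope ring_scope.

(** * Ideals and subrings as sets *)

Section Ideals.
Variable T : nzRingType.
Implicit Types A B C I J L R : set T.

Lemma zmod_closedP I :
  GRing.zmod_closed (mem I) <->
  I 0 /\ (forall x y, I x -> I y -> I (x - y)).
Proof.
split=> -[I0 IB]; split.
- exact: set_mem I0.
- by move=> x y /mem_set Ix /mem_set Iy; apply: set_mem; apply: IB.
- exact: mem_set I0.
- by move=> x y /set_mem Ix /set_mem Iy; apply: mem_set; apply: IB.
Qed.

Lemma subring_closedP R :
  is_subring R <->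
  [/\ R 1, forall x y, R x -> R y -> R (x - y)
    & forall x y, R x -> R y -> R (x * y)].
Proof.
split=> -[R1 RB RM]; split.
- exact: set_mem R1.
- by move=> x y /mem_set Rx /mem_set Ry; apply: set_mem; apply: RB.
- by move=> x y /mem_set Rx /mem_set Ry; apply: set_mem; apply: RM.
- exact: mem_set R1.
- by move=> x y /set_mem Rx /set_mem Ry; apply: mem_set; apply: RB.
- by move=> x y /set_mem Rx /set_mem Ry; apply: mem_set; apply: RM.
Qed.

Lemma left_idealP A I :
  left_ideal A I <->
  [/\ I `<=` A, I 0, forall x y, I x -> I y -> I (x - y)
    & forall a x, A a -> I x -> I (a * x)].
Proof.
by split=> [[IA /zmod_closedP[I0 IB] IM]|[IA I0 IB IM]]; split=> //;
  apply/zmod_closedP.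
Qed.

Lemma right_idealP A I :
  right_ideal A I <->
  [/\ I `<=` A, I 0, forall x y, I x -> I y -> I (x - y)
    & forall a x, A a -> I x -> I (x * a)].
Proof.
by split=> [[IA /zmod_closedP[I0 IB] IM]|[IA I0 IB IM]]; split=> //;
  apply/zmod_closedP.
Qed.

Lemma two_sided_idealP I :
  two_sided_ideal [set: T] I <->
  [/\ I 0, forall x y, I x -> I y -> I (x - y),
      forall a x, I x -> I (a * x) & forall a x, I x -> I (x * a)].
Proof.
split=> [[/left_idealP[_ I0 IB IMl] /right_idealP[_ _ _ IMr]]|[I0 IB IMl IMr]].
  by split=> // a x Ix; [apply: IMl | apply: IMr].
by split; [apply/left_idealP | apply/right_idealP]; split=> // a x _;
  [apply: IMl | apply: IMr].
Qed.

Lemma left_idealD A I : left_ideal A I -> forall x y, I x -> I y -> I (x + y).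
Proof.
move=> /left_idealP[_ I0 IB _] x y Ix Iy; rewrite -[y]opprK; apply: (IB) => //.
by rewrite -sub0r; apply: IB.
Qed.

Lemma right_idealD A I : right_ideal A I -> forall x y, I x -> I y -> I (x + y).
Proof.
move=> /right_idealP[_ I0 IB _] x y Ix Iy; rewrite -[y]opprK; apply: (IB) => //.
by rewrite -sub0r; apply: IB.
Qed.

Lemma maximal_ideal_full C J :
  maximal_ideal [set: T] C -> two_sided_ideal [set: T] J -> C `<=` J ->
  (exists2 x, J x & ~ C x) -> J = [set: T].
Proof.
move=> [_ _ maxC] idJ sCJ [x Jx nCx]; apply: contrapT => nJT; apply: maxC.
exists J; split=> //; split=> // sub; first exact: (nCx (sub _ Jx)).
by apply: nJT; apply/seteqP.
Qed.

(** A maximal two-sided ideal is prime, in the noncommutative sense. *)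
Lemma maximal_ideal_prime C a b :
  maximal_ideal [set: T] C -> ~ C a -> ~ C b -> exists t, ~ C (a * t * b).
Proof.
move=> maxC nCa nCb; apply: contrapT => /forallNP nC.
have [/two_sided_idealP[C0 CB CMl CMr] _ _] := maxC.
pose J := [set y | forall t, C (a * t * y)].
suff JT : J = [set: T].
  have J1 : J 1 by rewrite JT.
  by apply: nCa; have := J1 1; rewrite !mulr1.
apply: (maximal_ideal_full maxC) => [|y Cy t|].
- apply/two_sided_idealP; split=> [t|x y Jx Jy t|s x Jx t|s x Jx t].
  + by rewrite mulr0.
  + by rewrite mulrBr; apply: CB.
  + by rewrite mulrA -(mulrA a).
  + by rewrite mulrA; apply: CMr.
- exact: CMl.
- by exists b => // t; apply: contrapT.
Qed.

Lemma conductor_subl R : conductor R `<=` left_conductor R.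
Proof. by move=> x Cx t; rewrite -[_ * _]mulr1. Qed.

Lemma conductor_subr R : conductor R `<=` right_conductor R.
Proof. by move=> x Cx t; rewrite -[x]mul1r. Qed.

Lemma left_conductor_sub R : left_conductor R `<=` R.
Proof. by move=> x /(_ 1); rewrite mul1r. Qed.

Lemma right_conductor_sub R : right_conductor R `<=` R.
Proof. by move=> x /(_ 1); rewrite mulr1. Qed.

Lemma left_conductor_ideal R :
  is_subring R -> left_ideal [set: T] (left_conductor R).
Proof.
move=> /subring_closedP[R1 RB _]; apply/left_idealP; split=> //.
- by move=> t; rewrite mulr0 -(subrr 1); apply: RB.
- by move=> x y Rx Ry t; rewrite mulrBr; apply: RB.
- by move=> a x _ Rx t; rewrite mulrA.
Qed.

Lemma right_conductor_ideal R :
  is_subring R -> right_ideal [set: T] (right_conductor R).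
Proof.
move=> /subring_closedP[R1 RB _]; apply/right_idealP; split=> //.
- by move=> t; rewrite mul0r -(subrr 1); apply: RB.
- by move=> x y Rx Ry t; rewrite mulrBl; apply: RB.
- by move=> a x _ Rx t; rewrite -mulrA.
Qed.

End Ideals.

(** * Chain conditions *)

Section Chains.
Variable T : nzRingType.
Implicit Types A B C I J L R : set T.

Definition stationary (F : nat -> set T) : Prop :=
  exists N, forall n, (N <= n)%N -> F n = F N.

(** Inclusion if [up] holds, reverse inclusion otherwise. *)
Definition chain_rel (up : bool) A B : Prop :=
  if up then A `<=` B else B `<=` A.

(** The ascending chain condition if [up] holds, the descending one otherwise:
    in both cases it unfolds to the notion it stands for. *)
Definition chain_condition (up : bool) (P : set T -> Prop) : Prop :=
  forall F : nat -> set T,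
    (forall n, P (F n)) -> (forall n, chain_rel up (F n) (F n.+1)) ->
    stationary F.

Lemma chain_rel_leq up (F : nat -> set T) :
  (forall n, chain_rel up (F n) (F n.+1)) ->
  forall m n, (m <= n)%N -> chain_rel up (F m) (F n).
Proof.
move=> chF m n /subnK <-; elim: (n - m)%N => [|k IHk]; first by case: (up).
rewrite addSn; have := chF (k + m)%N; case: up IHk {chF} => /= s1 s2 x Fx.
  exact/s2/s1.
exact/s1/s2.
Qed.

(** A left ideal is determined, among those comparable with it, by its image
    under the right multiplication by [a] and by its intersection with the
    kernel of this map. *)
Lemma eq_left_ideal_mulr a A B :
  left_ideal [set: T] A -> left_ideal [set: T] B -> A `<=` B ->
  [set t * a | t in A] = [set t * a | t in B] ->
  A `&` [set t | t * a = 0] = B `&` [set t | t * a = 0] -> A = B.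
Proof.
move=> idA idB sAB eq_im eq_ker; apply/seteqP; split=> // t Bt.
have /left_idealP[_ _ BB _] := idB.
have [s As sat] : [set t * a | t in A] (t * a) by rewrite eq_im; exists t.
have [Ats _] : (A `&` [set t | t * a = 0]) (t - s).
  rewrite eq_ker; split; first by apply: BB => //; apply: sAB.
  by rewrite /= mulrBl sat subrr.
by rewrite -(subrK s t); apply: left_idealD idA _ _ _ _.
Qed.

Lemma stationary_mulr up a (F : nat -> set T) :
  (forall n, left_ideal [set: T] (F n)) ->
  (forall n, chain_rel up (F n) (F n.+1)) ->
  stationary (fun n => [set t * a | t in F n]) ->
  stationary (fun n => F n `&` [set t | t * a = 0]) -> stationary F.
Proof.
move=> idF chF [N1 im] [N2 ker]; exists (maxn N1 N2) => n leNn.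
have [le1 le2] : (N1 <= n)%N /\ (N2 <= n)%N.
  by move: leNn; rewrite geq_max => /andP.
have eq_im : [set t * a | t in F (maxn N1 N2)] = [set t * a | t in F n].
  by rewrite (im n) // im // leq_maxl.
have eq_ker : F (maxn N1 N2) `&` [set t | t * a = 0]
            = F n `&` [set t | t * a = 0].
  by rewrite (ker n) // ker // leq_maxr.
have := chain_rel_leq chF leNn; case: up {chF} => /= sF.
  by apply/esym/(@eq_left_ideal_mulr a).
exact: (@eq_left_ideal_mulr a).
Qed.

(** The chain is stationary because [t |-> (t * a)_(a in s)] is injective on
    its terms, with values in a power of the left ideal [A] of [R]; by induction
    on [s], one element of it at a time. *)
Lemma stationary_seq_annihilator up R A (s : seq T) (F : nat -> set T) :
  left_ideal [set: T] A -> A `<=` R ->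
  chain_condition up (left_ideal R) ->
  (forall a, a \in s -> A a) ->
  (forall n, left_ideal [set: T] (F n)) ->
  (forall n, chain_rel up (F n) (F n.+1)) ->
  (forall n t, F n t -> (forall a, a \in s -> t * a = 0) -> t = 0) ->
  stationary F.
Proof.
move=> /left_idealP[_ _ _ AM] sAR ccR.
elim: s F => [|a s IHs] F sA idF chF annF.
  exists 0%N => n _; apply/seteqP.
  by split=> x Fx; rewrite (annF _ _ Fx) //;
    [have /left_idealP[] := idF 0%N | have /left_idealP[] := idF n].
have Aa : A a by apply: sA; rewrite mem_head.
apply: (stationary_mulr (a := a) idF chF).
  apply: ccR => n.
    have /left_idealP[_ F0 FB FM] := idF n; apply/left_idealP; split.
    - by move=> _ [t _ <-]; apply/sAR/AM.
    - by exists 0; rewrite ?mul0r.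
    - move=> _ _ [t Ft <-] [t' Ft' <-]; exists (t - t'); first exact: FB.
      by rewrite mulrBl.
    - move=> r _ Rr [t Ft <-]; exists (r * t); first exact: FM.
      by rewrite mulrA.
  by have := chF n; case: (up) => /= sF _ [t Ft <-]; exists t => //; apply: sF.
apply: IHs => [b sb|n|n|n t [Ft ta0] ann].
- by apply: sA; rewrite inE sb orbT.
- have /left_idealP[_ F0 FB FM] := idF n; apply/left_idealP; split=> //.
  + by split=> //=; rewrite mul0r.
  + move=> x y [Fx xa] [Fy ya]; split; first exact: FB.
    by rewrite /= mulrBl xa ya subrr.
  + move=> b x _ [Fx xa]; split; first exact: FM.
    by rewrite /= -mulrA xa mulr0.
- by have := chF n; case: (up) => /= sF x [Fx xa]; split=> //; apply: sF.
- by apply: (annF n) => // b; rewrite inE => /predU1P[->|/ann].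
Qed.

Lemma annihilator_free_seq C A :
  maximal_ideal [set: T] C -> left_ideal [set: T] A -> C `<=` A -> A <> C ->
  exists2 s : seq T, (forall a, a \in s -> A a)
    & forall t, (forall a, a \in s -> t * a = 0) -> t = 0.
Proof.
move=> maxC /left_idealP[_ _ _ AM] sCA nAC.
(* This set contains the ideal generated by A: if y is the sum of the products
   of the a in s by elements of T, then t y vanishes when all the t a do. *)
pose J := [set y | exists2 s : seq T, (forall a, a \in s -> A a)
            & forall t, (forall a, a \in s -> t * a = 0) -> t * y = 0].
have sAJ : A `<=` J.
  move=> a Aa; exists [:: a] => [b|t]; first by rewrite inE => /eqP->.
  by apply; rewrite mem_head.
suff JT : J = [set: T].
  have [s sA ann] : J 1 by rewrite JT.
  by exists s => // t /ann; rewrite mulr1.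
apply: (maximal_ideal_full maxC).
- apply/two_sided_idealP; split.
  + by exists [::] => // t _; rewrite mulr0.
  + move=> x y [s1 s1A ann1] [s2 s2A ann2]; exists (s1 ++ s2) => [a|t ann].
      by rewrite mem_cat => /orP[/s1A|/s2A].
    rewrite mulrBr ann1 ?ann2 ?subrr // => a sa; apply: ann;
      by rewrite mem_cat sa ?orbT.
  + move=> b x [s sA ann]; exists [seq b * a | a <- s] => [c|t tann].
      by move=> /mapP[a /sA Aa ->]; apply: AM.
    rewrite mulrA; apply: ann => a sa.
    by rewrite -mulrA; apply: tann; apply: map_f.
  + move=> b x [s sA ann]; exists s => // t tann.
    by rewrite mulrA ann ?mul0r.
- by move=> x /sCA/sAJ.
- apply: contrapT => nJC; apply: nAC; apply/seteqP; split=> // x Ax.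
  by apply: contrapT => nCx; apply: nJC; exists x => //; apply: sAJ.
Qed.

Lemma chain_condition_up up R C A :
  maximal_ideal [set: T] C -> left_ideal [set: T] A -> C `<=` A -> A `<=` R ->
  A <> C -> chain_condition up (left_ideal R) ->
  chain_condition up (left_ideal [set: T]).
Proof.
move=> maxC idA sCA sAR nAC ccR F idF chF.
have [s sA ann] := annihilator_free_seq maxC idA sCA nAC.
apply: (stationary_seq_annihilator idA sAR ccR sA idF chF) => n t _.
exact: ann.
Qed.

(** A right ideal strictly containing a maximal ideal generates [T] as a left
    ideal, since the left ideal that it generates is two-sided. *)
Lemma left_ideal_sup_right C I K :
  maximal_ideal [set: T] C -> right_ideal [set: T] I -> C `<=` I -> I <> C ->
  left_ideal [set: T] K -> I `<=` K -> K 1.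
Proof.
move=> maxC /right_idealP[_ _ _ IM] sCI nIC idK sIK.
pose J := [set y | forall L, left_ideal [set: T] L -> I `<=` L -> L y].
suff JT : J = [set: T] by have J1 : J 1 by [rewrite JT]; apply: J1.
apply: (maximal_ideal_full maxC).
- apply/two_sided_idealP; split=> [L|x y Jx Jy L|b x Jx L|b x Jx L] idL sIL;
    have /left_idealP[_ L0 LB LM] := idL => //.
  + by apply: LB; [apply: Jx | apply: Jy].
  + by apply: LM => //; apply: Jx.
  + apply: (Jx [set z | L (z * b)]); last by move=> i Ii; apply/sIL/IM.
    apply/left_idealP; split=> //=.
    * by rewrite mul0r.
    * by move=> z z' Lz Lz'; rewrite mulrBl; apply: LB.
    * by move=> a z _ Lz; rewrite -mulrA; apply: LM.
- by move=> x /sCI Ix L _; apply.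
- apply: contrapT => nJC; apply: nIC; apply/seteqP; split=> // x Ix.
  by apply: contrapT => nCx; apply: nJC; exists x => // L _; apply.
Qed.

(** A left ideal [L] of [T] is determined by the left ideal [L :&: I] of [R],
    since [L = T I L] and [I L] is contained in [L :&: I]. *)
Lemma left_artinian_up R C I :
  maximal_ideal [set: T] C -> right_ideal [set: T] I -> C `<=` I -> I <> C ->
  left_ideal R I -> left_artinian R -> left_artinian [set: T].
Proof.
move=> maxC ridI sCI nIC /left_idealP[sIR I0 IB IMl] artR F idF chF.
have /right_idealP[_ _ _ IMr] := ridI.
have [] := artR (fun n => F n `&` I).
- move=> n; have /left_idealP[_ F0 FB FM] := idF n.
  apply/left_idealP; split=> [x [_ /sIR]|||] //.
  + by move=> x y [Fx Ix] [Fy Iy]; split; [apply: FB | apply: IB].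
  + by move=> r x Rr [Fx Ix]; split; [apply: FM | apply: IMl].
- by move=> n x [/chF Fx Ix].
move=> N statN; exists N => n leNn.
have det m k : F m `&` I = F k `&` I -> F m `<=` F k.
  move=> eqF x Fx; have /left_idealP[_ F0 FB FM] := idF k.
  (* The left ideal of those y with y x in F k contains I. *)
  suff : [set y | F k (y * x)] 1 by rewrite /= mul1r.
  apply: (left_ideal_sup_right maxC ridI sCI nIC).
    apply/left_idealP; split=> //=.
    + by rewrite mul0r.
    + by move=> y z Fy Fz; rewrite mulrBl; apply: FB.
    + by move=> a y _ Fy; rewrite -mulrA; apply: FM.
  move=> y Iy; suff [] : (F k `&` I) (y * x) by [].
  rewrite -eqF; split; last exact: IMr.
  by have /left_idealP[_ _ _] := idF m; apply.
by apply/seteqP; split; apply: det; rewrite (statN n).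
Qed.

Lemma descending_chain_min (P Q : set T -> Prop) :
  descending_chain_condition P -> (forall A, Q A -> P A) -> (exists A, Q A) ->
  exists2 M, Q M & forall A, Q A -> A `<=` M -> A = M.
Proof.
move=> dccP sQP [A0 QA0]; apply: contrapT => nomin.
have next (u : {A | Q A}) : exists v : {A | Q A}, sval v `<` sval u.
  apply: contrapT => nnext; apply: nomin; exists (sval u) => [|A QA sAu].
    exact: (svalP u).
  apply: contrapT => neqA; apply: nnext; exists (exist _ A QA); split=> // suA.
  by apply: neqA; apply/seteqP.
have [f fP] := choice next.
pose F n := iter n f (exist _ A0 QA0).
have [n|n x|N statN] := dccP (fun n => sval (F n)).
- by apply: sQP; apply: (svalP (F n)).
- by have [sF _] := fP (F n); apply: sF.
- have [_] := fP (F N); apply; rewrite -[f (F N)]/(F N.+1).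
  by rewrite (statN N.+1).
Qed.

End Chains.

(** * Simple left Artinian quotients *)

Section SimpleArtinian.
Variable T : nzRingType.
Implicit Types C I L M R : set T.

(** Modulo [C], a minimal left ideal [M] is generated by an idempotent, found
    as follows. If [M q] is not zero, then the right multiplication by [q] is a
    bijection of [M]. The preimage [z] of [q] is a right identity of [M], and
    if [s] is the preimage of [z], then [z] is also [q s]. Thus [z] belongs to
    every right ideal that contains [C] and [q]. *)
Lemma minimal_left_ideal_idempotent C M q x :
  maximal_ideal [set: T] C -> left_ideal [set: T] M -> C `<=` M ->
  (forall L, left_ideal [set: T] L -> C `<=` L -> L `<=` M ->
     (exists2 y, L y & ~ C y) -> L = M) ->
  M q -> M x -> ~ C (x * q) ->
  exists z, [/\ M z, ~ C z, C (z * z - z) & exists s, C (z - q * s)].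
Proof.
move=> [[idC ridC] _ _] idM sCM minM Mq Mx nCxq.
have /two_sided_idealP[C0 CB CMl CMr] : two_sided_ideal [set: T] C by [].
have /left_idealP[_ M0 MB MM] := idM.
have CD := left_idealD idC.
have Csym y y' : C (y - y') -> C (y' - y).
  by move=> Cy; rewrite -opprB -sub0r; apply: CB.
have inj y : M y -> C (y * q) -> C y.
  move=> My Cyq; apply: contrapT => nCy; apply: nCxq.
  suff [] : (M `&` [set w | C (w * q)]) x by [].
  rewrite (minM (M `&` [set w | C (w * q)])) //.
  - apply/left_idealP; split=> //.
    + by split=> //=; rewrite mul0r.
    + move=> w w' [Mw Cw] [Mw' Cw']; split; first exact: MB.
      by rewrite /= mulrBl; apply: CB.
    + move=> a w _ [Mw Cw]; split; first exact: MM.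
      by rewrite /= -mulrA; apply: CMl.
  - by move=> w Cw; split; [apply: sCM | apply: CMr].
  - by exists y.
have surj y : M y -> exists2 m, M m & C (y - m * q).
  pose L := [set w | M w /\ exists2 m, M m & C (w - m * q)].
  have eqML : M = L.
    apply/esym/minM.
    - apply/left_idealP; split=> //.
      + by split=> //; exists 0 => //; rewrite mul0r subr0.
      + move=> w w' [Mw [m Mm Cw]] [Mw' [m' Mm' Cw']]; split; first exact: MB.
        exists (m - m'); first exact: MB.
        have -> : w - w' - (m - m') * q = w - m * q - (w' - m' * q).
          by rewrite mulrBl !opprD !opprK addrACA.
        exact: CB.
      + move=> a w _ [Mw [m Mm Cw]]; split; first exact: MM.
        exists (a * m); first exact: MM.
        by rewrite -mulrA -mulrBr; apply: CMl.
    - move=> w Cw; split; first exact: sCM.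
      by exists 0 => //; rewrite mul0r subr0.
    - by move=> w [].
    - exists (x * q) => //; split; first exact: MM.
      by exists x => //; rewrite subrr.
  by move=> My; have [] : L y by rewrite -eqML.
have [z Mz Cz] := surj q Mq.
have Mz1 m : M m -> C (m * z - m).
  move=> Mm; apply: inj; first by apply: MB => //; apply: MM.
  by rewrite mulrBl -mulrA -mulrBr; apply: CMl; apply: Csym.
have [s Ms Cs] := surj z Mz.
exists z; split=> //; last 1 first.
- exists s; apply: inj; first by apply: MB => //; apply: MM.
  have -> : (z - q * s) * q = (z * q - q) + ((q - q * z) + q * (z - s * q)).
    by rewrite mulrBr subrKA subrKA mulrBl mulrA.
  by apply: (CD); [apply: Csym | apply: CD; [apply/Csym/Mz1 | apply: CMl]].
- move=> CCz; apply/nCxq/CMl; rewrite -(subrK (z * q) q).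
  by apply: CD => //; apply: CMr.
- exact: Mz1.
Qed.

(** In the simple left Artinian ring [T / C], the proper right ideal [I / C] has
    a nonzero left annihilator. Otherwise, still modulo [C], choose [u] in
    [1 + I] such that [T u] is minimal; a minimal left ideal inside [T u] then
    contains a nonzero idempotent [z] of [I], and [T u (1 - z)] is strictly
    smaller than [T u] since it does not contain [z]. *)
Lemma left_annihilator_mod C I :
  left_artinian [set: T] -> maximal_ideal [set: T] C ->
  right_ideal [set: T] I -> C `<=` I -> ~ I 1 ->
  exists2 x, ~ C x & forall i, I i -> C (x * i).
Proof.
move=> artT maxC ridI sCI nI1; apply: contrapT => noann.
have [[idC ridC] _ _] := maxC.
have /two_sided_idealP[C0 CB CMl CMr] : two_sided_ideal [set: T] C by [].
have /right_idealP[_ I0 IB IM] := ridI.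
have CD := left_idealD idC; have ID := right_idealD ridI.
have annI x : ~ C x -> exists2 i, I i & ~ C (x * i).
  move=> nCx; apply: contrapT => nex; apply: noann; exists x => // i Ii.
  by apply: contrapT => nCxi; apply: nex; exists i.
pose gen u := [set x | exists r, C (x - r * u)].
have gen_ideal u : left_ideal [set: T] (gen u).
  apply/left_idealP; split=> //.
  - by exists 0; rewrite mul0r subr0.
  - move=> x y [r Cx] [r' Cy]; exists (r - r').
    have -> : x - y - (r - r') * u = x - r * u - (y - r' * u).
      by rewrite mulrBl !opprD !opprK addrACA.
    exact: CB.
  - move=> a x _ [r Cx]; exists (a * r).
    by rewrite -mulrA -mulrBr; apply: CMl.
have sCgen u : C `<=` gen u by move=> x Cx; exists 0; rewrite mul0r subr0.
have gen_self u : gen u u by exists 1; rewrite mul1r subrr.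
have [||_ [u [Iu ->]] minu] := @descending_chain_min _ _
    (fun L => exists u, I (1 - u) /\ L = gen u) artT.
- by move=> _ [u [_ ->]].
- by exists (gen 1), 1; rewrite subrr.
have nCu : ~ C u.
  by move=> Cu; apply: nI1; rewrite -(subrK u 1); apply: ID => //; apply: sCI.
have [||M [idM sCM sMu [x Mx nCx]] minM] := @descending_chain_min _ _
    (fun L => [/\ left_ideal [set: T] L, C `<=` L, L `<=` gen u
                & exists2 x, L x & ~ C x]) artT.
- by move=> L [].
- by exists (gen u); split=> //; exists u.
have [i Ii nCxi] := annI x nCx.
have [t nCxitx] := maximal_ideal_prime maxC nCxi nCx.
have Iq : I (i * t * x) by rewrite -mulrA; apply: IM.
have Mq : M (i * t * x) by have /left_idealP[_ _ _] := idM; apply.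
have [||z [Mz nCz Czz [s Cs]]] :=
    @minimal_left_ideal_idempotent C M (i * t * x) x maxC idM sCM _ Mq Mx.
- by move=> L idL sCL sLM nLC; apply: minM => //; split=> // y /sLM/sMu.
- by rewrite !mulrA.
have Iz : I z.
  rewrite -(subrK (i * t * x * s) z); apply: ID; first exact: sCI.
  exact: IM.
have Iuz : I (u * z).
  rewrite -[u](subKr 1) mulrBl mul1r; apply: (IB) => //.
  exact: IM.
have Iv : I (1 - u * (1 - z)).
  by rewrite mulrBr mulr1 opprB addrCA addrC; apply: ID.
have gen_uz : gen (u * (1 - z)) = gen u.
  apply: minu; first by exists (u * (1 - z)).
  move=> y [r Cy].
  have /left_idealP[_ _ genB genM] := gen_ideal u.
  rewrite -(subrK (r * (u * (1 - z))) y).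
  apply: left_idealD (gen_ideal u) _ _ (sCgen _ _ Cy) _; apply: (genM) => //.
  rewrite mulrBr mulr1; apply: genB => //; apply: genM => //.
  exact: sMu.
have [r Cr] : gen (u * (1 - z)) z by rewrite gen_uz; apply: sMu.
apply: nCz.
(* Modulo C, multiplying z = r u (1 - z) on the right by z gives z = 0. *)
have -> : z = (z - r * (u * (1 - z))) * z - (1 + r * u) * (z * z - z).
  rewrite mulrBl -!mulrA mulrBl mul1r mulrDl mul1r -mulrA -(opprB (z * z)).
  by rewrite !mulrN opprK opprD addrACA subrr addr0 subKr.
apply: CB; [exact: CMr | exact: CMl].
Qed.

End SimpleArtinian.

(** * Maximal subrings *)

Section MaximalSubring.
Variable T : nzRingType.
Implicit Types I R : set T.

(** For a right ideal [I] of [T], the largest subring of [T] containing [I] as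
    a two-sided ideal. *)
Definition idealizer I : set T := [set x | forall i, I i -> I (x * i)].

Lemma idealizer_subring I :
  right_ideal [set: T] I -> is_subring (idealizer I).
Proof.
move=> /right_idealP[_ _ IB _]; apply/subring_closedP; split.
- by move=> i Ii; rewrite mul1r.
- by move=> x y Ix Iy i Ii; rewrite mulrBl; apply: IB; [apply: Ix | apply: Iy].
- by move=> x y Ix Iy i Ii; rewrite -mulrA; apply/Ix/Iy.
Qed.

Lemma idealizer_maximal R I :
  maximal_subring R -> right_ideal [set: T] I -> left_ideal R I ->
  idealizer I <> [set: T] -> idealizer I = R.
Proof.
move=> [_ _ maxR] ridI /left_idealP[_ _ _ IM] nT.
have sRI : R `<=` idealizer I by move=> r Rr i Ii; apply: IM.
apply: contrapT => nIR; apply: maxR; exists (idealizer I); split.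
- exact: idealizer_subring.
- by split=> // sIR; apply: nIR; apply/seteqP.
- by split=> // sTI; apply: nT; apply/seteqP.
Qed.

Lemma right_conductor_left_ideal R :
  is_subring R -> left_ideal R (right_conductor R).
Proof.
move=> subR; have /right_idealP[_ C0 CB _] := right_conductor_ideal subR.
have /subring_closedP[_ _ RM] := subR; apply/left_idealP; split=> //.
  exact: right_conductor_sub.
by move=> r x Rr Cx t; rewrite -mulrA; apply: RM.
Qed.

Lemma conductor_eq_right R :
  maximal_subring R -> maximal_ideal [set: T] (conductor R) ->
  left_artinian R -> conductor R = left_conductor R ->
  right_conductor R = conductor R.
Proof.
move=> maxR maxC artR eqCl; apply: contrapT => nCr.
have [subR properR _] := maxR.
have /subring_closedP[R1 _ _] := subR.
have ridI := right_conductor_ideal subR.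
have lidI := right_conductor_left_ideal subR.
have sCI := @conductor_subr _ R.
have nI1 : ~ right_conductor R 1.
  by move=> I1; case: properR => _; apply=> t _; have := I1 t; rewrite mul1r.
have artT := left_artinian_up maxC ridI sCI nCr lidI artR.
have [x nCx xI] := left_annihilator_mod artT maxC ridI sCI nI1.
have idealR : idealizer (right_conductor R) = R.
  apply: (idealizer_maximal maxR) => // idT; apply: nI1.
  suff -> : right_conductor R = [set: T] by [].
  apply: (maximal_ideal_full maxC) => //.
    have /right_idealP[_ I0 IB IM] := ridI.
    apply/two_sided_idealP; split=> // a i Ii; last exact: IM.
    have : idealizer (right_conductor R) a by rewrite idT.
    exact.
  apply: contrapT => nex; apply: nCr; apply/seteqP; split=> // i Ii.
  by apply: contrapT => nCi; apply: nex; exists i.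
apply: nCx; rewrite eqCl => t; rewrite -idealR => i Ii.
rewrite -mulrA; apply: sCI.
have [[/left_idealP[_ _ _ CM] _] _ _] := maxC.
by apply: CM => //; apply: xI.
Qed.

Lemma left_chain_condition_maximal_subring R :
  maximal_subring R -> maximal_ideal [set: T] (conductor R) ->
  (left_noetherian R ->
     (left_noetherian [set: T] \/ conductor R = left_conductor R) /\
     (conductor R = left_conductor R ->
        left_conductor R `<=` right_conductor R)) /\
  (left_artinian R ->
     (left_artinian [set: T] \/ conductor R = left_conductor R) /\
     (conductor R = left_conductor R ->
        conductor R = left_conductor R /\
        left_conductor R = right_conductor R)).
Proof.
move=> maxR maxC; have [subR _ _] := maxR.
have up b : chain_condition b (left_ideal R) ->
    chain_condition b (left_ideal [set: T]) \/ conductor R = left_conductor R.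
  move=> ccR; have [?|nCl] := pselect (conductor R = left_conductor R).
    by right.
  left; apply: (chain_condition_up maxC (left_conductor_ideal subR)) ccR.
  - exact: conductor_subl.
  - exact: left_conductor_sub.
  - by move=> eqCl; apply: nCl.
split=> ccR; split.
- exact: (up true).
- by move=> <-; apply: conductor_subr.
- exact: (up false).
- by move=> eqCl; split=> //; rewrite -eqCl (conductor_eq_right maxR).
Qed.

End MaximalSubring.

(** * The converse ring *)

Section Converse.
Variable T : nzRingType.
Implicit Types A R : set T.

Lemma is_subring_converse R : is_subring (R : set T^c) <-> is_subring R.
Proof.
by split=> /subring_closedP[R1 RB RM]; apply/subring_closedP; split=> // x y Rx;
  move/RM; apply.
Qed.

Lemma maximal_subring_converse R :
  maximal_subring R -> maximal_subring (R : set T^c).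
Proof.
move=> [subR properR maxR]; split=> //; first exact/is_subring_converse.
move=> [S [subS sRS sST]]; apply: maxR; exists S; split=> //.
exact/is_subring_converse.
Qed.

Lemma two_sided_ideal_converse A I :
  two_sided_ideal (A : set T^c) I <-> two_sided_ideal A I.
Proof. by split=> -[]. Qed.

Lemma maximal_ideal_converse A I :
  maximal_ideal A I -> maximal_ideal (A : set T^c) I.
Proof.
move=> [idI sIA maxI]; split=> //; first exact/two_sided_ideal_converse.
move=> [J [idJ sIJ sJA]]; apply: maxI; exists J; split=> //.
exact/two_sided_ideal_converse.
Qed.

Lemma conductor_converse R : conductor (R : set T^c) = conductor R.
Proof.
apply/seteqP; split=> x Cx s t; first by rewrite -mulrA; apply: (Cx t s).
by have := Cx t s; rewrite -mulrA.
Qed.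

End Converse.

Local Close Scope ring_scope.
Unset Implicit Arguments.

Theorem corollary4p3 (T : nzRingType) (R : set T)
    (maxR : maximal_subring R)
    (maxC : maximal_ideal [set: T] (conductor R)) :
  ((left_noetherian R ->
      (left_noetherian [set: T] \/ conductor R = left_conductor R) /\
      (conductor R = left_conductor R ->
         left_conductor R `<=` right_conductor R)) /\
   (left_artinian R ->
      (left_artinian [set: T] \/ conductor R = left_conductor R) /\
      (conductor R = left_conductor R ->
         conductor R = left_conductor R /\
         left_conductor R = right_conductor R)))
  /\
  ((right_noetherian R ->
      (right_noetherian [set: T] \/ conductor R = right_conductor R) /\
      (conductor R = right_conductor R ->
         right_conductor R `<=` left_conductor R)) /\
   (right_artinian R ->
      (right_artinian [set: T] \/ conductor R = right_conductor R) /\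
      (conductor R = right_conductor R ->
         conductor R = left_conductor R /\
         left_conductor R = right_conductor R))).
Proof.
split; first exact: left_chain_condition_maximal_subring.
have := @left_chain_condition_maximal_subring T^c R
  (maximal_subring_converse maxR).
rewrite conductor_converse => /(_ (maximal_ideal_converse maxC)).
(* The left-hand notions of the converse ring unfold to the right-hand ones. *)
move=> [noeth artin]; split; first exact: noeth.
move=> /artin[artT eqC]; split=> [|/eqC[eqCr eqrl]]; first exact: artT.
by split; [exact: etrans eqCr eqrl | exact: esym eqrl].
Qed.
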